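(* Let $G=(V,E)$ be a directed graph with $n$ vertices and $\mathbb{F}$ a finite field. For all $u,v\in V$ let $x_{u,v}\in\mathbb{F}$ be a uniformly random element, and for all $v\in V$ let $y_v\in\mathbb{F}$ be a uniformly random element, all sampled independently. Let $A\in\mathbb{F}^{n\times n}$ be defined by $A_{u,v}=x_{u,v}\cdot y_v$ if $u=v$ or $uv\in E$, and $A_{u,v}=0$ otherwise. Then, with probability at least $1-n^4/|\mathbb{F}|$: (1) $A$ is generic; and (2) for every $u,v\in V$ and $k\in [n-1]$, $(A^k)_{u,v}\neq 0$ if and only if there exists a path $u\to v$ in $G$ of length at most $k$.
   Context: A matrix is generic if its characteristic polynomial equals its minimal polynomial. $V$ is identified with $[n]=\{1,\ldots,n\}$ to index rows/columns; the length of a path is its number of edges. *)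

(* Defs.v *)
From HB Require Import structures.
From mathcomp Require Import all_boot all_order all_algebra.

Set Implicit Arguments.
Unset Strict Implicit.
Unset Printing Implicit Defensive.

Import Order.TTheory GRing.Theory Num.Theory.

Local Open Scope ring_scope.

(* Uniform probability of an event on a nonempty finite sample space. When T is
   a finite product of copies of F, its coordinates are independent and uniformly
   distributed on F. *)
Definition unifPr (T : finType) (X : {set T}) : rat := #|X|%:R / #|T|%:R.

(* mxminpoly only exists in positive dimension; the minimal polynomial of the
   empty matrix is 1, since 1 = 0 in the zero ring 'M_0. *)
Definition minpoly (F : fieldType) (n : nat) : 'M[F]_n -> {poly F} :=
  if n is _.+1 then fun A => mxminpoly A else fun=> 1.

Definition generic (F : fieldType) (n : nat) (A : 'M[F]_n) : bool :=
  char_poly A == minpoly A.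

Definition graph_mx (F : fieldType) (n : nat) (E : rel 'I_n)
    (x : 'M[F]_n) (y : 'rV[F]_n) : 'M[F]_n :=
  \matrix_(u, v) if (u == v) || E u v then x u v * y 0 v else 0.

(* The path u :: p has size p edges and no repeated vertex; bounded sequences
   form a finite type, which makes the existential boolean. *)
Definition has_path_le (n : nat) (E : rel 'I_n) (k : nat) (u v : 'I_n) : bool :=
  [exists p : k.-bseq 'I_n, [&& path E u p, uniq (u :: p) & last u p == v]].

Definition powers_detect_paths (F : fieldType) (n : nat) (E : rel 'I_n)
    (A : 'M[F]_n) : bool :=
  [forall u, forall v, forall k : 'I_n,
     (0 < k)%N ==> (((A ^+ k) u v != 0) == has_path_le E k u v)].

(* Main.v *)
(* The failure of each required nonvanishing condition is the vanishing of a
   function of (x, y) that is polynomial along every line: the entry (u, v) of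
   A^k, of degree 2k, for each of the k < n such that a path of length at most k
   exists, and, for genericity, the determinant of the Krylov matrix of the
   all-ones vector, of degree n(n-1). A degree-d function that is nonzero
   somewhere has at most d |V| / (q-1) zeros. With N = |V|, the union bound gives
   (q-1) #bad <= (n^2 + 1) n (n-1) N, and adding #bad <= N yields
   q #bad <= n^4 N for n > 0. *)
From HB Require Import structures.
Require Import Defs.
From mathcomp Require Import all_boot all_order all_algebra.
From mathcomp Require Import zify.

Import Order.TTheory GRing.Theory Num.Theory.

Local Open Scope ring_scope.

Set Implicit Arguments.
Unset Strict Implicit.
Unset Printing Implicit Defensive.

(* Makes a product of two finLmodTypes a finLmodType. *)
HB.saturate prod.

(** Stands in for total degree at most [d] without multivariate polynomials: the zero count below
    only restricts [f] to lines. *)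
Definition line_deg_le (F : fieldType) (V : lmodType F) (f : V -> F) (d : nat) :=
  forall a b : V, exists2 P : {poly F},
    (size P <= d.+1)%N & forall t, f (a + t *: b) = P.[t].

(** * Degree along lines, and counting zeros *)

Section LineDegree.
Variables (F : fieldType) (V : lmodType F).
Implicit Types (f g : V -> F) (d e : nat).

Lemma line_deg_le_ext f g d : f =1 g -> line_deg_le f d -> line_deg_le g d.
Proof.
by move=> fg df a b; have [P sP fP] := df a b; exists P => // t; rewrite -fg fP.
Qed.

Lemma line_deg_le_cst (c : F) d : line_deg_le (fun _ : V => c) d.
Proof.
move=> a b; exists c%:P => [|t]; last by rewrite hornerC.
by rewrite (leq_trans (size_polyC_leq1 c)).
Qed.

Lemma line_deg_le_linear (f : {linear V -> F^o}) : line_deg_le f 1.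
Proof.
move=> a b; exists ((f a)%:P + (f b) *: 'X) => [|t].
  rewrite (leq_trans (size_polyD _ _)) // geq_max.
  rewrite (leq_trans (size_polyC_leq1 _)) //=.
  by rewrite (leq_trans (size_scale_leq _ _)) // size_polyX.
by rewrite linearD linearZ /= !hornerE mulrC.
Qed.

Lemma line_deg_leD f g d :
  line_deg_le f d -> line_deg_le g d -> line_deg_le (fun z => f z + g z) d.
Proof.
move=> df dg a b; have [P sP fP] := df a b; have [Q sQ gQ] := dg a b.
exists (P + Q) => [|t]; last by rewrite hornerD fP gQ.
by rewrite (leq_trans (size_polyD _ _)) // geq_max sP.
Qed.

Lemma line_deg_leM f g d e :
  line_deg_le f d -> line_deg_le g e ->
  line_deg_le (fun z => f z * g z) (d + e).
Proof.
move=> df dg a b; have [P sP fP] := df a b; have [Q sQ gQ] := dg a b.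
exists (P * Q) => [|t]; last by rewrite hornerM fP gQ.
apply: leq_trans (size_polyMleq _ _) _.
by have := leq_add sP sQ; rewrite addSn addnS; case: (_ + _)%N.
Qed.

Lemma line_deg_le_sum (I : Type) (r : seq I) (f : I -> V -> F) d :
  (forall i, line_deg_le (f i) d) ->
  line_deg_le (fun z => \sum_(i <- r) f i z) d.
Proof.
move=> df; elim: r => [|i r IHr].
  by apply: line_deg_le_ext (line_deg_le_cst 0 d) => z; rewrite big_nil.
by apply: line_deg_le_ext (line_deg_leD (df i) IHr) => z; rewrite big_cons.
Qed.

Lemma line_deg_le_prod (I : Type) (r : seq I) (f : I -> V -> F) (d : I -> nat) :
  (forall i, line_deg_le (f i) (d i)) ->
  line_deg_le (fun z => \prod_(i <- r) f i z) (\sum_(i <- r) d i).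
Proof.
move=> df; elim: r => [|i r IHr].
  by apply: line_deg_le_ext (line_deg_le_cst 1 _) => z; rewrite big_nil.
rewrite big_cons.
by apply: line_deg_le_ext (line_deg_leM (df i) IHr) => z; rewrite big_cons.
Qed.

Lemma line_deg_le_expmx n (A : V -> 'M[F]_n) d k :
  (forall i j, line_deg_le (fun z => A z i j) d) ->
  forall i j, line_deg_le (fun z => (A z ^+ k) i j) (k * d).
Proof.
move=> dA; elim: k => [|k IHk] i j.
  apply: line_deg_le_ext (line_deg_le_cst ((1%:M : 'M[F]_n) i j) _) => z.
  by rewrite expr0.
pose f l z := A z i l * (A z ^+ k) l j.
apply: (@line_deg_le_ext (fun z => \sum_l f l z)).
  by move=> z; rewrite exprS mxE.
by apply: line_deg_le_sum => l; apply: line_deg_leM.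
Qed.

(** Each Leibniz term takes one entry from every row, so row bounds add up. They may differ: row [i]
    of a Krylov matrix involves the [i]-th power. *)
Lemma line_deg_le_det n (A : V -> 'M[F]_n) (d : 'I_n -> nat) :
  (forall i j, line_deg_le (fun z => A z i j) (d i)) ->
  line_deg_le (fun z => \det (A z)) (\sum_i d i).
Proof.
move=> dA; apply: line_deg_le_sum => s; rewrite -[X in line_deg_le _ X]add0n.
by apply: line_deg_leM; [apply: line_deg_le_cst | apply: line_deg_le_prod].
Qed.

End LineDegree.

(* On each line through p, f restricts to a nonzero polynomial, hence vanishes
   at no more than d points; these lines cover V, meeting only at p. *)
Lemma card_zeros_line_deg (F : finFieldType) (V : finLmodType F)
    (f : V -> F) (d : nat) (p : V) :
  line_deg_le f d -> f p != 0 ->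
  (#|F|.-1 * #|[set z | f z == 0%R]| <= d * #|V|)%N.
Proof.
move=> df fp0; set Z := [set z | _].
(* For [t != 0] the map [z |-> p + t *: z] permutes [V]. *)
have cardZ (t : F) : t != 0 ->
    (\sum_(z : V) (f (p + t *: z)%R == 0%R) = #|Z|)%N.
  move=> t0; rewrite -sum1_card [RHS]big_mkcond /=.
  pose g z := t^-1 *: (z - p).
  have gK : cancel (fun z => p + t *: z) g.
    by move=> z; rewrite /g addrC addKr scalerA mulVf // scale1r.
  have Kg : cancel g (fun z => p + t *: z).
    by move=> z; rewrite /g scalerA mulfV // scale1r subrKC.
  rewrite [RHS](reindex (fun z => p + t *: z)) /=; last by exists g => z _.
  by apply: eq_bigr => z _; rewrite inE; case: (_ == _).
have -> : (#|F|.-1 * #|Z| = \sum_(t : F | t != 0%R) #|Z|)%N.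
  rewrite sum_nat_const; congr (_ * _)%N.
  by rewrite -(@cardC1 F 0); apply: eq_card => t; rewrite !inE.
(* Double counting of the pairs [(t, z)] with [t != 0] and [f (p + t *: z) = 0]: it now suffices
   that each direction [z] admits at most [d] values of [t]. *)
rewrite -(eq_bigr _ cardZ) exchange_big /= mulnC.
have -> : (#|V| * d = \sum_(z : V) d)%N by rewrite sum_nat_const.
apply: leq_sum => z _.
have [P sP fP] := df p z.
have P0 : P != 0.
  apply: contra fp0 => /eqP P0; have := fP 0.
  by rewrite scale0r addr0 P0 horner0 => ->.
have -> : (\sum_(t | t != 0%R) (f (p + t *: z)%R == 0%R) =
           #|[pred t | (t != 0%R) && root P t]|)%N.
  rewrite -sum1_card big_mkcondr; apply: eq_bigr => t _.
  by rewrite fP rootE; case: (_ == _).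
rewrite cardE -ltnS (leq_trans _ sP) // max_poly_roots ?enum_uniq //.
by apply/allP => t; rewrite mem_enum => /andP[].
Qed.

(** * Krylov matrices and genericity *)

Definition krylov_mx (F : fieldType) (n : nat) (w : 'rV[F]_n) (A : 'M[F]_n) : 'M[F]_n :=
  \matrix_(i, j) (w *m A ^+ i) 0 j.

(** A minimal polynomial of degree below [n] would make the rows [w *m A ^+ i] linearly dependent.
    So its degree is at least [n], and as a monic divisor of the characteristic polynomial it equals
    it. *)
Lemma krylov_generic (F : fieldType) (n : nat) (w : 'rV[F]_n) (A : 'M[F]_n) :
  \det (krylov_mx w A) != 0 -> generic A.
Proof.
rewrite /generic /minpoly; case: n w A => [|m] w A.
  by move=> _; rewrite /char_poly det_mx00.
move=> detK; set p := mxminpoly A.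
have pm : p \is monic by apply: mxminpoly_monic.
suff sp : (m.+1 < size p)%N.
  rewrite eq_sym -(eqp_monic pm (char_poly_monic A)).
  rewrite -(dvdp_size_eqp (mxminpoly_dvd_char A)) eqn_leq.
  rewrite dvdp_leq ?mxminpoly_dvd_char ?monic_neq0 ?char_poly_monic //.
  by rewrite size_char_poly.
rewrite ltnNge; apply: contra detK => sp; apply/det0P.
exists (\row_i p`_i).
  (* The coefficient vector is nonzero because it contains the leading coefficient 1. *)
  have s0 : (0 < size p)%N by rewrite size_poly_gt0 monic_neq0.
  have lt_m : ((size p).-1 < m.+1)%N by rewrite prednK.
  apply/eqP => /rowP/(_ (Ordinal lt_m)); rewrite !mxE /= => /eqP.
  by rewrite -lead_coefE (monicP pm) oner_eq0.
have pA : \sum_(i < m.+1) p`_i *: A ^+ i = 0.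
  transitivity (horner_mx A p); last exact: mx_root_minpoly.
  rewrite -[p in RHS]coefK poly_def rmorph_sum /=.
  rewrite (big_ord_widen _ (fun i => horner_mx A (p`_i *: 'X^i)) sp).
  rewrite [RHS]big_mkcond; apply: eq_bigr => i _.
  rewrite linearZ rmorphXn /= horner_mx_X; case: ltnP => // /(nth_default 0) ->.
  by rewrite scale0r.
apply/rowP => j; transitivity ((w *m \sum_(i < m.+1) p`_i *: A ^+ i) 0 j).
  rewrite mulmx_sumr summxE mxE; apply: eq_bigr => i _.
  by rewrite -scalemxAr !mxE.
by rewrite pA mulmx0.
Qed.

Lemma leq_card_bigcup (T : finType) (I : Type) (r : seq I) (P : pred I)
    (A : I -> {set T}) :
  (#|\bigcup_(i <- r | P i) A i| <= \sum_(i <- r | P i) #|A i|)%N.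
Proof.
elim/big_rec2: _ => [|i m B _ le_B]; first by rewrite cards0.
by rewrite (leq_trans (leq_card_setU _ _)) // leq_add2l.
Qed.

(** * Powers of the graph matrix, and witnesses of nonvanishing *)

Section GraphMatrix.
Variables (F : fieldType) (n : nat) (E : rel 'I_n).
Implicit Types (u v : 'I_n) (k : nat).

Local Notation sample := ('M[F]_n * 'rV[F]_n)%type.
Local Notation A := (fun xy : sample => graph_mx E xy.1 xy.2).

Lemma graph_mx_line_deg i j : line_deg_le (fun xy => A xy i j) 2.
Proof.
case Eij: ((i == j) || E i j); last first.
  by apply: line_deg_le_ext (line_deg_le_cst 0 _) => xy; rewrite mxE Eij.
pose x (xy : sample) : F^o := xy.1 i j.
have x_lin : linear x by move=> a b c; rewrite /x /= !mxE.
pose y (xy : sample) : F^o := xy.2 0 j.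
have y_lin : linear y by move=> a b c; rewrite /y /= !mxE.
pose xM := GRing.isLinear.Build _ _ _ _ x x_lin.
pose yM := GRing.isLinear.Build _ _ _ _ y y_lin.
pose xL : {linear sample -> F^o} := HB.pack x xM.
pose yL : {linear sample -> F^o} := HB.pack y yM.
apply: (@line_deg_le_ext _ _ (fun xy => xL xy * yL xy)) => [xy|].
  by rewrite mxE Eij.
exact: (line_deg_leM (line_deg_le_linear xL) (line_deg_le_linear yL)).
Qed.

(** This direction holds for every sample: a nonzero term of the expanded power is a walk of edges
    and diagonal steps. Dropping the diagonal steps and shortcutting repeated vertices leaves a
    path. *)
Lemma graph_mx_exp_neq0 (xy : sample) k u v :
  (A xy ^+ k) u v != 0 -> has_path_le E k u v.
Proof.
move=> Ak.
suff [p [Ep lp sp]] :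
    exists p, [/\ path E u p, last u p = v & (size p <= k)%N].
  move: lp; case: (shortenP Ep) => q Eq Uq qp lq.
  have sq : (size q <= k)%N.
    by apply: leq_trans sp; apply: uniq_leq_size => //; case/andP: Uq.
  by apply/existsP; exists (Bseq sq); rewrite Eq Uq lq eqxx.
elim: k u Ak => [|k IHk] u.
  rewrite expr0 mxE; case: (eqVneq u v) => [-> _|_]; last by rewrite eqxx.
  by exists [::].
rewrite exprS mxE => Ak.
have [w] : exists w, A xy u w * (A xy ^+ k) w v != 0.
  apply/existsP; apply: contraR Ak; rewrite negb_exists => /forallP Ak.
  by rewrite big1 // => w _; apply/eqP; rewrite -[_ == _]negbK.
rewrite mulf_eq0 negb_or mxE => /andP[Auw /IHk[p [Ep lp sp]]].
(* A diagonal step uses up one factor of the power but adds no edge. *)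
move: Auw; case: (eqVneq u w) => [->|_] /=.
  by exists p; split=> //; apply: leqW.
case Euw: (E u w); last by rewrite eqxx.
by exists (w :: p); rewrite /= Euw.
Qed.

(** Column [b] is the basis vector indexed by [f b], so multiplying such matrices composes the
    functions. *)
Lemma expmx_fun (f : 'I_n -> 'I_n) k :
  (\matrix_(a, b) (a == f b)%:R : 'M[F]_n) ^+ k =
  \matrix_(a, b) (a == iter k f b)%:R.
Proof.
elim: k => [|k IHk]; apply/matrixP => a b; first by rewrite expr0 !mxE.
rewrite exprS IHk !mxE (bigD1 (iter k f b)) //= !mxE eqxx mulr1 big1 ?addr0 //.
by move=> c ne_c; rewrite !mxE (negPf ne_c) mulr0.
Qed.

(* Send each vertex of the path to its predecessor and fix all others: the
   resulting 0/1 matrix is supported on E and the diagonal, and the entry (u, v)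
   of its k-th power counts the length-k walk that idles at u and then follows
   the path. *)
Lemma path_graph_mx_witness k u v : has_path_le E k u v ->
  exists xy : sample, (A xy ^+ k) u v != 0.
Proof.
case/existsP=> p /and3P[/(pathP u) Ep Up /eqP lp].
set s := u :: p in Up.
(* Since [0.-1 = 0], the start [u] is a fixed point, which provides the idling. *)
pose f b := if b \in s then nth u s (index b s).-1 else b.
have fE b : (f b == b) || E (f b) b.
  rewrite /f; case: ifP => [sb|_]; last by rewrite eqxx.
  have := nth_index u sb; have := sb; rewrite -index_mem.
  case: (index b s) => [|i] /= lt_i <-; first by rewrite eqxx.
  by rewrite Ep ?orbT.
exists (\matrix_(a, b) (a == f b)%:R, const_mx 1).
have -> : A (\matrix_(a, b) (a == f b)%:R, const_mx 1) =
          \matrix_(a, b) (a == f b)%:R.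
  apply/matrixP => a b; rewrite !mxE mulr1; case: ifP => // /norP.
  by case: (eqVneq a (f b)) => // -> [/negPf fb /negPf Eb]; rewrite -(fE b) fb Eb.
have iterf i m : (m < size s)%N -> iter i f (nth u s m) = nth u s (m - i)%N.
  move=> lt_m; elim: i => [|i IHi]; first by rewrite subn0.
  have lt_mi : (m - i < size s)%N by apply: leq_ltn_trans lt_m; apply: leq_subr.
  by rewrite iterS IHi /f mem_nth // index_uniq // subnS.
have -> : v = nth u s (size p) by rewrite -lp (last_nth u).
(* As [size p <= k], the truncated difference is 0: going back [k] steps from [v] ends at [u]. *)
rewrite expmx_fun mxE iterf // (eqP (size_bseq p : _ - _ == 0)%N) eqxx.
exact: oner_neq0.
Qed.

(** Diagonal entries are allowed for every [E]; a diagonal matrix with distinct entries turns the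
    Krylov matrix of the all-ones vector into a Vandermonde matrix. *)
Lemma krylov_graph_mx_witness (c : 'I_n -> F) : injective c ->
  exists xy : sample, \det (krylov_mx (const_mx 1) (A xy)) != 0.
Proof.
move=> c_inj; pose y : 'rV[F]_n := \row_j c j; exists (1%:M, y).
have Ad : A (1%:M, y) = diag_mx y.
  apply/matrixP => a b; rewrite !mxE /=.
  by case: eqVneq => [->|_] /=; rewrite ?mul1r // mul0r if_same.
have -> : krylov_mx (const_mx 1) (A (1%:M, y)) = Vandermonde n y.
  apply/matrixP => i j; rewrite Ad !mxE.
  have -> (k : nat) : diag_mx y ^+ k = diag_mx (\row_j y 0 j ^+ k).
    elim: k => [|k IHk]; last first.
      rewrite exprS IHk; apply: etrans (mulmx_diag _ _) _.
      by congr diag_mx; apply/rowP => a; rewrite !mxE exprS.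
    by apply/matrixP => a b; rewrite expr0 !mxE expr0.
  rewrite (bigD1 j) //= !mxE eqxx mul1r big1 ?addr0 // => a /negPf ne_aj.
  by rewrite !mxE ne_aj mul1r.
rewrite det_Vandermonde; apply/prodf_neq0 => i _; apply/prodf_neq0 => j lt_ij.
by rewrite !mxE subr_eq0 (inj_eq c_inj) neq_ltn lt_ij orbT.
Qed.

Lemma krylov_graph_mx_line_deg (w : 'rV[F]_n) :
  line_deg_le (fun xy => \det (krylov_mx w (A xy))) (\sum_(i < n) i * 2).
Proof.
apply: line_deg_le_det => i j.
pose f l xy := w 0 l * (A xy ^+ i) l j.
apply: (@line_deg_le_ext _ _ (fun xy => \sum_l f l xy)).
  by move=> xy; rewrite !mxE.
apply: line_deg_le_sum => l; rewrite -[(i * 2)%N]add0n.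
apply: line_deg_leM; first exact: line_deg_le_cst.
by apply: (line_deg_le_expmx (A := A)) => a b; apply: graph_mx_line_deg.
Qed.

End GraphMatrix.

(** * The union bound *)

Theorem theorem10 (n : nat) (E : rel 'I_n) (F : finFieldType) :
  1 - (n ^ 4)%:R / #|F|%:R <=
  unifPr [set xy : 'M[F]_n * 'rV[F]_n |
            generic (graph_mx E xy.1 xy.2) &&
            powers_detect_paths E (graph_mx E xy.1 xy.2)].
Proof.
set X := [set xy | _]; set N := #|{: 'M[F]_n * 'rV[F]_n}|.
have q_gt0 : (0 < #|F|)%N by apply/card_gt0P; exists 0.
have N_gt0 : (0 < N)%N by apply/card_gt0P; exists 0.
suff bad : (#|F| * #|~: X| <= n ^ 4 * N)%N.
  have cX : #|X|%:R = N%:R - #|~: X|%:R :> rat.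
    by rewrite /N -(cardsC X) natrD addrK.
  rewrite /unifPr -/N cX mulrBl divff ?pnatr_eq0 -?lt0n // lerD2l lerN2.
  rewrite ler_pdivrMr ?ltr0n // mulrAC ler_pdivlMr ?ltr0n // -!natrM ler_nat.
  by rewrite mulnC.
have le_bad : (#|~: X| <= N)%N by apply: max_card.
(* For [#|F| < n] the bound is trivial; otherwise [F] has the [n] distinct elements that the
   Vandermonde witness needs. *)
have [lt_q|le_q] := ltnP #|F| n.
  apply: leq_mul => //; apply: leq_trans (ltnW lt_q) _.
  by rewrite -{1}[n]expn1 leq_pexp2l // (leq_trans _ lt_q).
pose A (xy : 'M[F]_n * 'rV[F]_n) := graph_mx E xy.1 xy.2.
pose Z (f : 'M[F]_n * 'rV[F]_n -> F) := [set xy | f xy == 0].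
pose D xy := \det (krylov_mx (const_mx 1) (A xy)).
pose P u v k xy := (A xy ^+ k) u v.
pose S := (\sum_(i < n) i * 2)%N.
have cover : ~: X \subset Z D :|:
    \bigcup_u \bigcup_v \bigcup_(k < n | has_path_le E k u v) Z (P u v k).
  apply/subsetP => xy; rewrite !inE; apply: contraR.
  rewrite negb_or => /andP[/krylov_generic -> /= Pxy].
  apply/forallP => u; apply/forallP => v; apply/forallP => k.
  apply/implyP => _; apply/eqP; apply/idP/idP; first exact: graph_mx_exp_neq0.
  move=> Ek; apply: contra Pxy => Pk.
  apply/bigcupP; exists u => //; apply/bigcupP; exists v => //.
  by apply/bigcupP; exists k; rewrite // inE.
have ZD : (#|F|.-1 * #|Z D| <= S * N)%N.
  have c_inj : injective (fun i : 'I_n => enum_val (widen_ord le_q i)).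
    by move=> i j /enum_val_inj/(congr1 val)/= /val_inj.
  have [xy Dxy] := krylov_graph_mx_witness E c_inj.
  exact: card_zeros_line_deg (krylov_graph_mx_line_deg E _) Dxy.
have ZP u v k : has_path_le E k u v ->
    (#|F|.-1 * #|Z (P u v k)| <= k * 2 * N)%N.
  case/(path_graph_mx_witness F) => xy Pxy; apply: card_zeros_line_deg Pxy.
  by apply: (line_deg_le_expmx (A := A)) => i j; apply: graph_mx_line_deg.
have sumn c : (n * c = \sum_(i < n) c)%N.
  by rewrite sum_nat_const card_ord.
have bound : (#|F|.-1 * #|~: X| <= (S + n * (n * S)) * N)%N.
  apply: leq_trans (leq_mul (leqnn _) (subset_leq_card cover)) _.
  apply: leq_trans (leq_mul (leqnn _) (leq_card_setU _ _)) _.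
  rewrite mulnDr mulnDl leq_add //.
  apply: leq_trans (leq_mul (leqnn _) (leq_card_bigcup _ _ _)) _.
  rewrite big_distrr -mulnA sumn leq_sum // => u _.
  apply: leq_trans (leq_mul (leqnn _) (leq_card_bigcup _ _ _)) _.
  rewrite big_distrr -mulnA sumn leq_sum // => v _.
  apply: leq_trans (leq_mul (leqnn _) (leq_card_bigcup _ _ _)) _.
  rewrite /S big_distrr big_distrl [leqRHS]big_mkcond /= big_mkcond.
  by apply: leq_sum => k _; case: ifP => // /ZP.
have S_def : (S + n = n * n)%N.
  rewrite /S; elim: (n) => [|m IHm]; first by rewrite big_ord0.
  rewrite big_ord_recr /=; move: IHm.
  by move: (\sum_(i < m) _)%N => s; nia.
have q_gt1 : (1 < #|F|)%N := card_finNzRing_gt1 F.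
(* For [n = 0] the right-hand side vanishes, so there must be no bad sample at all; [S = 0] and
   [#|F| > 1] give this. *)
have [n0|n_gt0] := posnP n.
  move: bound; have -> : S = 0%N by apply/eqP; rewrite -(eqn_add2r n) S_def n0.
  rewrite !muln0 mul0n leqn0 muln_eq0 => /orP[/eqP|/eqP ->]; first lia.
  by rewrite muln0.
(* With [S = n^2 - n], the left-hand side is [n^4 - n^3 + n^2 - n + 1]. *)
have le_D : ((S + n * (n * S)).+1 <= n ^ 4)%N by rewrite !expnS expn0; nia.
apply: leq_trans (leq_mul le_D (leqnn N)).
by rewrite mulSn -{1}(prednK q_gt0) mulSn leq_add.
Qed.
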